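(* Let $A\in\mathbb{C}_{n,n}$ with $\mathrm{Ind}(A)=k$, and let $A=U\begin{bmatrix}T&S\\0&N\end{bmatrix}U^\ast$ with $U$ unitary, $T$ non-singular and $N$ nilpotent, be the block form of $A$ given by its core-EP decomposition. Let $A^{(\dag)}$ be the core-EP inverse of $A$. Then the system of equations in $X\in\mathbb{C}_{n,n}$ $$AX^2=X,\qquad AX=A^{(\dag)}A$$ is consistent and has a unique solution, namely $$X=U\begin{bmatrix}T^{-1}&T^{-2}S\\0&0\end{bmatrix}U^\ast .$$
   Context: $\mathbb{C}_{m,n}$ is the set of complex $m\times n$ matrices and $A^\ast$ the conjugate transpose. The index $\mathrm{Ind}(A)$ is the smallest positive integer $k$ with $\mathrm{rk}(A^{k+1})=\mathrm{rk}(A^k)$. Core-EP decomposition (known): every $A\in\mathbb{C}_{n,n}$ with $\mathrm{Ind}(A)=k$ can be written uniquely as $A=A_1+A_2$ with $\mathrm{Ind}(A_1)=1$, $A_2^k=0$ and $A_1^\ast A_2=A_2A_1=0$ (one or both of $A_1,A_2$ may be null), and there is a unitary $U$ with $A_1=U\begin{bmatrix}T&S\\0&0\end{bmatrix}U^\ast$, $A_2=U\begin{bmatrix}0&0\\0&N\end{bmatrix}U^\ast$, where $T$ is non-singular and $N$ is nilpotent (blocks may be empty). The core-EP inverse of $A$ is $A^{(\dag)}=U\begin{bmatrix}T^{-1}&0\\0&0\end{bmatrix}U^\ast$; it does not depend on the choice of $U$. *)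

(* Defs.v *)
From mathcomp Require Import all_boot all_order all_algebra.
From mathcomp Require Import boolp classical_sets reals.
From mathcomp Require Import complex.

Set Implicit Arguments.
Unset Strict Implicit.
Unset Printing Implicit Defensive.

Import Order.TTheory GRing.Theory Num.Theory.
Local Open Scope ring_scope.
Local Open Scope sesquilinear_scope.

Lemma mxindex_ex (F : fieldType) n (A : 'M[F]_n) :
  exists k, (0 < k)%N && (\rank (A ^+ k.+1) == \rank (A ^+ k)).
Proof.
have [/existsP[i ri]|/existsPn nri] :=
  boolP [exists i : 'I_n.+1, \rank (A ^+ i.+2) == \rank (A ^+ i.+1)].
  by exists i.+1.
have rankS (j : nat) : (j <= n.+1)%N -> (\rank (A ^+ j.+1) + j <= n)%N.
  elim: j => [_|j IHj ltj]; first by rewrite addn0 rank_leq_row.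
  apply: leq_trans (IHj (ltnW ltj)); rewrite addnS ltn_add2r ltn_neqAle.
  by rewrite (nri (Ordinal ltj)) [X in (\rank X <= _)%N]exprS mxrankM_maxr.
by have := leq_trans (leq_addl _ _) (rankS _ (leqnn n.+1)); rewrite ltnn.
Qed.

Definition mxindex (F : fieldType) n (A : 'M[F]_n) : nat :=
  ex_minn (mxindex_ex A).

Definition nilpotent_mx (F : fieldType) n (N : 'M[F]_n) : Prop :=
  exists j : nat, N ^+ j = 0.

(* The block sizes r and m may be zero; e identifies 'M_(r + m) with 'M_n. *)
Definition ublock (C : numClosedFieldType) n r m (e : (r + m)%N = n)
    (U : 'M[C]_n) (P : 'M[C]_r) (Q : 'M[C]_(r, m))
    (V : 'M[C]_(m, r)) (W : 'M[C]_m) : 'M[C]_n :=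
  U *m castmx (e, e) (block_mx P Q V W) *m U^t*.

Definition core_EP_decomposition (C : numClosedFieldType) n
    (A A1 A2 : 'M[C]_n) : Prop :=
  [/\ A = A1 + A2, mxindex A1 = 1%N, A2 ^+ mxindex A = 0,
      A1^t* *m A2 = 0 & A2 *m A1 = 0].

Definition core_EP_block_form (C : numClosedFieldType) n r m
    (e : (r + m)%N = n) (A U : 'M[C]_n)
    (T : 'M[C]_r) (S : 'M[C]_(r, m)) (N : 'M[C]_m) : Prop :=
  [/\ U \is unitarymx, T \in unitmx, nilpotent_mx N &
      core_EP_decomposition A (ublock e U T S 0 0) (ublock e U 0 0 0 N)].

Definition is_core_EP_inverse (C : numClosedFieldType) n
    (A Y : 'M[C]_n) : Prop :=
  exists r m (e : (r + m)%N = n) (U : 'M[C]_n)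
      (T : 'M[C]_r) (S : 'M[C]_(r, m)) (N : 'M[C]_m),
    core_EP_block_form e A U T S N /\ Y = ublock e U (invmx T) 0 0 0.

(* The value Y is chosen classically. The default 0 would be returned only if
   A had no core-EP block form. *)
Definition core_EP_inverse (C : numClosedFieldType) n (A : 'M[C]_n) : 'M[C]_n :=
  xget 0 [set Y | is_core_EP_inverse A Y]%classic.

Lemma core_EP_block_formE (C : numClosedFieldType) n r m
    (e : (r + m)%N = n) (A U : 'M[C]_n)
    (T : 'M[C]_r) (S : 'M[C]_(r, m)) (N : 'M[C]_m) :
  core_EP_block_form e A U T S N -> A = ublock e U T S 0 N.
Proof.
case=> _ _ _ [-> _ _ _ _]; rewrite /ublock -mulmxDl -mulmxDr.
case: n / e {A} U => U.
by rewrite !castmx_id add_block_mx !addr0 add0r.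
Qed.

(* Main.v *)
Require Import Defs.
From mathcomp Require Import all_boot all_order all_algebra.
From mathcomp Require Import boolp classical_sets reals.
From mathcomp Require Import complex.

(** Let Y be the core-EP inverse of A.  Three identities carry everything:
    A Y^2 = Y, the matrix A Y is Hermitian, and Y A^(j+1) = A^j for all large j.
    The first one already solves the system.  If A X^2 = X and A X = Y A, then
      X = (A X) X = Y (A X) = Y^2 A,
    so Y^2 A is the only candidate; conversely A (Y^2 A) = (A Y^2) A = Y A and
    A (Y^2 A)^2 = Y (A Y^2) A = Y^2 A.  A block computation gives
    Y^2 A = U [T^-1, T^-2 S; 0, 0] U^*.

    All three identities are needed to see that Y does not depend on the
    unitary triangularization chosen to compute it ([core_EP_inverse_unique]).
    If Y and Z both satisfy them, then A Y and A Z are orthogonal projections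
    with the same range, that of A^j for j large, hence they are equal, and
    Y = A^j Y^(j+1) = Z A^(j+1) Y^(j+1) = Z A Y = Z A Z = Z. *)

Set Implicit Arguments.
Unset Strict Implicit.
Unset Printing Implicit Defensive.

Import Order.TTheory GRing.Theory Num.Theory.
Local Open Scope ring_scope.
Local Open Scope sesquilinear_scope.

(** Hence y lies in the right ideal generated by every power of a. *)
Lemma mul_expr_outer (R : pzRingType) (a y : R) j :
  a * y ^+ 2 = y -> a ^+ j * y ^+ j.+1 = y.
Proof.
move=> ayy; elim: j => [|j IHj]; first by rewrite mul1r.
by rewrite exprSr -mulrA -(addn2 j) addnC exprD (mulrA a) ayy -exprS.
Qed.

Lemma outer_system_unique (R : pzRingType) (a x y : R) :
  a * x ^+ 2 = x -> a * x = y * a -> x = y ^+ 2 * a.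
Proof.
move=> axx ax.
by rewrite -{1}axx !expr2 mulrA ax -mulrA ax mulrA.
Qed.

Lemma outer_system_solution (R : pzRingType) (a y : R) (x := y ^+ 2 * a) :
  a * y ^+ 2 = y -> a * x ^+ 2 = x /\ a * x = y * a.
Proof.
move=> ayy; have ax : a * x = y * a by rewrite mulrA ayy.
by split=> //; rewrite expr2 mulrA ax -mulrA ax mulrA -expr2.
Qed.

(** Left multiplication by z a fixes every element of the form a^j w, and y is
    of that form by [mul_expr_outer]. *)
Lemma outer_absorb (R : pzRingType) (a y z : R) j :
  a * y ^+ 2 = y -> z * a ^+ j.+1 = a ^+ j -> z * (a * y) = y.
Proof.
move=> ayy zaj; rewrite -[y in LHS](mul_expr_outer j ayy).
by rewrite (mulrA a) -exprS mulrA zaj mul_expr_outer.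
Qed.

(** An equational substitute for the block description: it mentions neither
    the unitary matrix nor the block sizes, so two triangularizations of
    different shapes can be compared. *)
Definition core_EP_equations (C : numClosedFieldType) n (A Y : 'M[C]_n) :=
  [/\ A * Y ^+ 2 = Y, (A * Y)^t* = A * Y &
      exists j, Y * A ^+ j.+1 = A ^+ j].

Lemma adjmxM (C : numClosedFieldType) n (A B : 'M[C]_n) :
  (A * B)^t* = B^t* * A^t*.
Proof. by rewrite -!mulmxE trmx_mul map_mxM. Qed.

(** With P = A Y and Q = A Z, absorption gives Q P = P and P Q = Q; as P and Q
    are Hermitian, taking adjoints in P Q = Q yields Q P = Q, so P = Q.  Then
    Y = Z P and Z = Z Q coincide. *)
Lemma core_EP_equations_unique (C : numClosedFieldType) n (A Y Z : 'M[C]_n) :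
  core_EP_equations A Y -> core_EP_equations A Z -> Y = Z.
Proof.
move=> [AYY hY [i Yi]] [AZZ hZ [j Zj]].
have ZAY := outer_absorb AYY Zj; have YAZ := outer_absorb AZZ Yi.
have ZAZ := outer_absorb AZZ Zj.
have AYZ : A * Y = A * Z.
  have idY : (A * Z) * (A * Y) = A * Y by rewrite -mulrA ZAY.
  have idZ : (A * Y) * (A * Z) = A * Z by rewrite -mulrA YAZ.
  by rewrite -[RHS]hZ -idZ adjmxM hZ hY idY.
by rewrite -ZAY AYZ.
Qed.

Lemma ublockM (C : numClosedFieldType) n r m (e : (r + m)%N = n) (U : 'M[C]_n)
    (P P' : 'M[C]_r) (Q Q' : 'M[C]_(r, m))
    (V V' : 'M[C]_(m, r)) (W W' : 'M[C]_m) :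
  U \is unitarymx ->
  ublock e U P Q V W * ublock e U P' Q' V' W' =
  ublock e U (P *m P' + Q *m V') (P *m Q' + Q *m W')
             (V *m P' + W *m V') (V *m Q' + W *m W').
Proof.
move=> Uu; rewrite /ublock; case: n / e U Uu => U Uu.
by rewrite !castmx_id -mulmx_block -mulmxE !mulmxA mulmxKtV.
Qed.

Lemma ublock_adj (C : numClosedFieldType) n r m (e : (r + m)%N = n)
    (U : 'M[C]_n) (P : 'M[C]_r) (Q : 'M[C]_(r, m))
    (V : 'M[C]_(m, r)) (W : 'M[C]_m) :
  (ublock e U P Q V W)^t* = ublock e U (P^t*) (V^t*) (Q^t*) (W^t*).
Proof.
rewrite /ublock; case: n / e U => U.
by rewrite !castmx_id !trmx_mul !map_mxM tr_block_mx map_block_mx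
  trmxCK mulmxA.
Qed.

Lemma ublock_triangular_exp (C : numClosedFieldType) n r m
    (e : (r + m)%N = n) (U : 'M[C]_n)
    (T : 'M[C]_r) (S : 'M[C]_(r, m)) (N : 'M[C]_m) j :
  U \is unitarymx ->
  exists S', ublock e U T S 0 N ^+ j = ublock e U (T ^+ j) S' 0 (N ^+ j).
Proof.
move=> Uu; elim: j => [|j [S' IHj]].
  exists 0; rewrite !expr0 /ublock; case: n / e U Uu => U Uu.
  rewrite castmx_id -scalar_mx_block mulmx1.
  exact/esym/unitarymxP.
exists (T *m S' + S *m N ^+ j).
by rewrite !exprS IHj ublockM // !(mulmx0, mul0mx, addr0, add0r).
Qed.

(** The nilpotent block disappears from A^j for large j, and what remains has
    range in the first r coordinates, where U [T^-1, 0; 0, 0] U^* inverts A. *)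
Lemma core_EP_equations_ublock (C : numClosedFieldType) n r m
    (e : (r + m)%N = n) (U : 'M[C]_n)
    (T : 'M[C]_r) (S : 'M[C]_(r, m)) (N : 'M[C]_m) :
  U \is unitarymx -> T \in unitmx -> nilpotent_mx N ->
  core_EP_equations (ublock e U T S 0 N) (ublock e U (invmx T) 0 0 0).
Proof.
move=> Uu Tu [j Nj].
have blk0 := (mulmx0, mul0mx, addr0, add0r).
split.
- by rewrite expr2 !ublockM // !blk0 mulKVmx.
- rewrite ublockM // !blk0 mulmxV // ublock_adj.
  by rewrite trmx1 map_mx1 !trmx0 !map_mx0.
- exists j; rewrite exprS mulrA ublockM // !blk0 mulVmx //.
  have [S' ->] := ublock_triangular_exp e T S N j Uu.
  by rewrite Nj ublockM // !blk0 !mul1mx.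
Qed.

Lemma ublock_outer_solution (C : numClosedFieldType) n r m
    (e : (r + m)%N = n) (U : 'M[C]_n)
    (T : 'M[C]_r) (S : 'M[C]_(r, m)) (N : 'M[C]_m) :
  U \is unitarymx -> T \in unitmx ->
  ublock e U (invmx T) 0 0 0 ^+ 2 * ublock e U T S 0 N =
  ublock e U (invmx T) (invmx T ^+ 2 *m S) 0 0.
Proof.
move=> Uu Tu; rewrite expr2 !ublockM // !(mulmx0, mul0mx, addr0, add0r).
by rewrite mulmxKV // -expr2.
Qed.

(** Every candidate value satisfies the characterizing equations, so the
    choice made in the definition of the core-EP inverse has only one possible
    outcome. *)
Lemma core_EP_inverse_unique (C : numClosedFieldType) n r m
    (e : (r + m)%N = n) (A U : 'M[C]_n)
    (T : 'M[C]_r) (S : 'M[C]_(r, m)) (N : 'M[C]_m) :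
  core_EP_block_form e A U T S N ->
  core_EP_inverse A = ublock e U (invmx T) 0 0 0.
Proof.
have eqns Y : is_core_EP_inverse A Y -> core_EP_equations A Y.
  move=> [r' [m' [e' [U' [T' [S' [N' [form ->]]]]]]]].
  rewrite (core_EP_block_formE form); case: form => Uu Tu Nn _.
  exact: core_EP_equations_ublock.
move=> form; set Y := RHS.
have inY : is_core_EP_inverse A Y by exists r, m, e, U, T, S, N.
apply: core_EP_equations_unique (eqns _ inY); apply: eqns.
exact: (@xgetPex _ 0 [set Z | is_core_EP_inverse A Z]%classic (ex_intro _ Y inY)).
Qed.

(** The scalars enter only through their field structure and conjugation, so C
    is left abstract; over R[i] itself, unification would have to compare much
    larger algebraic structures. *)
Lemma core_EP_system (C : numClosedFieldType) n r m
    (e : (r + m)%N = n) (A U : 'M[C]_n)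
    (T : 'M[C]_r) (S : 'M[C]_(r, m)) (N : 'M[C]_m)
    (X0 := ublock e U (invmx T) (invmx T ^+ 2 *m S) 0 0) :
  core_EP_block_form e A U T S N ->
  (A *m X0 ^+ 2 = X0 /\ A *m X0 = core_EP_inverse A *m A) /\
  (forall X : 'M[C]_n,
     A *m X ^+ 2 = X /\ A *m X = core_EP_inverse A *m A -> X = X0).
Proof.
move=> form; have hA := core_EP_block_formE form.
rewrite (core_EP_inverse_unique form) !mulmxE.
case: form => Uu Tu Nn _; set Y := ublock e U (invmx T) 0 0 0.
have [AYY _ _] : core_EP_equations A Y.
  by rewrite hA; exact: core_EP_equations_ublock.
have -> : X0 = Y ^+ 2 * A by rewrite hA ublock_outer_solution.
split; first exact: outer_system_solution.
by move=> X [AXX AX]; exact: outer_system_unique.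
Qed.

Local Close Scope sesquilinear_scope.

Theorem theorem3p1 (R : realType) (n r m k : nat) (e : (r + m)%N = n)
    (A U : 'M[R[i]]_n) (T : 'M[R[i]]_r) (S : 'M[R[i]]_(r, m)) (N : 'M[R[i]]_m)
    (hk : mxindex A = k)
    (hA : A = ublock e U T S 0 N)
    (hform : core_EP_block_form e A U T S N) :
  let X0 := ublock e U (invmx T) (invmx T ^+ 2 *m S) 0 0 in
  (A *m X0 ^+ 2 = X0 /\ A *m X0 = core_EP_inverse A *m A) /\
  (forall X : 'M[R[i]]_n,
     A *m X ^+ 2 = X /\ A *m X = core_EP_inverse A *m A -> X = X0).
Proof.
exact: core_EP_system hform.
Qed.
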